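(* Let $p$ be a prime and let $d,n,m$ be positive integers with $d \mid (p^m-1)$ and $p \mid n$. Let $\delta \in \mathbb{F}_{p^{mn}}$ with $\mathrm{Tr}_m^{mn}(\delta)=0$. Let $f_1(x)$ be a polynomial over $\mathbb{F}_{p^{mn}}$ and $\varphi(x)$ a polynomial over $\mathbb{F}_{p^m}$ such that (i) $\mathrm{Tr}_m^{mn}(f_1(x)) = \varphi(\mathrm{Tr}_m^{mn}(x))$ for all $x\in\mathbb{F}_{p^{mn}}$, and (ii) for every $a \in \mathbb{F}_{p^m}$, $f_1$ is injective on the preimage $\{x \in \mathbb{F}_{p^{mn}} : \mathrm{Tr}_m^{mn}(x)=a\}$. Let $k$ be a positive integer and, for $1\le i\le k$, let $b_i \in \mathbb{F}_{p^m}$ and let $s_i$ be positive integers. Put $$f(x)=\sum_{i=1}^k b_i\left(\mathrm{Tr}_m^{mn}(x)+\delta\right)^{1+s_i(p^{nm}-1)/d}+f_1(x).$$ Then $f$ permutes $\mathbb{F}_{p^{nm}}$ if and only if $\varphi$ permutes $\mathbb{F}_{p^m}$. Moreover, suppose $f$ permutes $\mathbb{F}_{p^{nm}}$ and there exist polynomials $\phi(x)$, $\bar\phi(x)$ over $\mathbb{F}_{p^{nm}}$ such that $\Psi(x):=\phi(f_1(x))+\bar\phi(\mathrm{Tr}_m^{mn}(x))$ permutes $\mathbb{F}_{p^{nm}}$. Let $h(x)=\sum_{i=1}^k b_i(x+\delta)^{1+s_i(p^{nm}-1)/d}$, let $\varphi^{-1}$ be the compositional inverse of $\varphi$ on $\mathbb{F}_{p^m}$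 and $\Psi^{-1}$ the compositional inverse of $\Psi$ on $\mathbb{F}_{p^{nm}}$. Then the compositional inverse of $f$ over $\mathbb{F}_{p^{nm}}$ is $$f^{-1}(x)=\Psi^{-1}\Big(\phi\big(x-h(\varphi^{-1}(\mathrm{Tr}_m^{mn}(x)))\big)+\bar\phi\big(\varphi^{-1}(\mathrm{Tr}_m^{mn}(x))\big)\Big).$$
   Context: For positive integers $m \mid N$, $\mathrm{Tr}_m^{N}:\mathbb{F}_{p^N}\to\mathbb{F}_{p^m}$ is the trace map $\mathrm{Tr}_m^N(x)=\sum_{j=0}^{N/m-1}x^{p^{jm}}$. The compositional inverse of a permutation polynomial $F$ of a finite field $\mathbb{F}$ is the unique polynomial map $F^{-1}$ on $\mathbb{F}$ with $F(F^{-1}(x))=F^{-1}(F(x))=x$ for all $x\in\mathbb{F}$. *)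

(* Defs.v *)
From HB Require Import structures.
From mathcomp Require Import all_boot all_order all_algebra.

Set Implicit Arguments.
Unset Strict Implicit.
Unset Printing Implicit Defensive.

Import GRing.Theory.
Local Open Scope ring_scope.

(* F_{p^N} is any finFieldType L with p ^ N elements. Its subfield F_{p^m} is
   a subset of L, so that polynomials over it are elements of polyOver K and
   the trace is an L-valued function. *)
Definition is_subfield (L : finFieldType) (q : nat) (K : {set L}) : Prop :=
  GRing.divring_closed K /\ #|K| = q.

Definition trace (L : finFieldType) (p m N : nat) (x : L) : L :=
  \sum_(j < N %/ m) x ^+ (p ^ (j * m)).

Definition permutes (L : finFieldType) (A : {set L}) (g : L -> L) : Prop :=
  [/\ {in A, forall x, g x \in A},
      {in A &, injective g}
    & {in A, forall y, exists2 x, x \in A & g x = y}].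

(* Only the values of g and g' on A matter. Every map of a finite field to
   itself is a polynomial map, so g' is not required to be given by a
   polynomial. *)
Definition comp_inverse (L : finFieldType) (A : {set L}) (g g' : L -> L) :
    Prop :=
  [/\ {in A, forall x, g x \in A}, {in A, forall x, g' x \in A},
      {in A, cancel g g'} & {in A, cancel g' g}].

Definition h_map (L : finFieldType) (p d n m k : nat) (delta : L)
    (b : 'I_k -> L) (s : 'I_k -> nat) (x : L) : L :=
  \sum_(i < k) b i * (x + delta) ^+ (1 + s i * (p ^ (n * m) - 1) %/ d).

Definition f_map (L : finFieldType) (p d n m k : nat) (delta : L)
    (b : 'I_k -> L) (s : 'I_k -> nat) (f1 : {poly L}) (x : L) : L :=
  \sum_(i < k) b i * (trace p m (m * n) x + delta)
                       ^+ (1 + s i * (p ^ (n * m) - 1) %/ d)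
  + f1.[x].

Definition Psi_map (L : finFieldType) (p n m : nat) (f1 phi phibar : {poly L})
    (x : L) : L :=
  phi.[f1.[x]] + phibar.[trace p m (m * n) x].

(* Main.v *)
Require Import Defs.
From HB Require Import structures.
From mathcomp Require Import all_boot all_order all_algebra.
From mathcomp Require Import finfield.

(* Write q = p ^ m and Q = p ^ (m * n). For y in F_q put u = y + delta; then
   Tr u = n y + Tr delta = 0 because p divides n. If u != 0, the factor
   u ^ (s (Q - 1) / d) is a d-th root of unity, hence lies in F_q, so the trace
   of each term of h y is an F_q-multiple of Tr u, and Tr (h y) = 0. Therefore
   Tr (f x) = varphi (Tr x): f maps the fibres of the trace to fibres of the
   trace according to varphi, and on each fibre it is a translate of f1. *)

Set Implicit Arguments.
Unset Strict Implicit.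
Unset Printing Implicit Defensive.

Import GRing.Theory.
Local Open Scope ring_scope.

Lemma expr_sum_pchar (R : comNzRingType) (p e : nat) (I : Type) (r : seq I)
    (P : pred I) (F : I -> R) :
  p \in [pchar R] ->
  (\sum_(i <- r | P i) F i) ^+ (p ^ e) = \sum_(i <- r | P i) F i ^+ (p ^ e).
Proof.
move=> pR; have p_gt0 : (0 < p)%N by rewrite prime_gt0 // (pcharf_prime pR).
apply: (big_morph (fun x : R => x ^+ (p ^ e))); last first.
  by rewrite expr0n expn_eq0 -leqn0 leqNgt p_gt0.
move=> x y; apply: exprDn_pchar; rewrite pnatX (eq_pnat _ (pcharf_eq pR)).
by rewrite pnat_id ?(pcharf_prime pR).
Qed.

Lemma expr_iter_fix (R : pzRingType) (q j : nat) (x : R) :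
  x ^+ q = x -> x ^+ (q ^ j) = x.
Proof. by move=> xq; elim: j => [|j IHj]; rewrite ?expr1 // expnS exprM xq. Qed.

(** Multiplication by a nonzero [y] of [K] permutes the nonzero elements of [K], so comparing their
    products gives [y ^+ (q - 1) = 1]. Conversely, [K] already supplies [q] roots of ['X^q - 'X],
    which leaves no room for another. *)
Lemma subfield_fixP (L : finFieldType) (q : nat) (K : {set L}) (x : L) :
  is_subfield q K -> reflect (x ^+ q = x) (x \in K).
Proof.
case=> [[K1 KB KD] cardK].
have K0 : 0 \in K by rewrite -(subrr 1) KB.
have Kfix y : y \in K -> y ^+ q = y.
  move=> Ky; have [->|y0] := eqVneq y 0.
    by rewrite expr0n -cardK (cardsD1 0 K) K0.
  (* Closure is given for quotients, so products are obtained as quotients by an inverse. *)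
  have KV z : z \in K -> z^-1 \in K by move=> Kz; rewrite -[_^-1]mul1r KD.
  have KM z : (z * y \in K) = (z \in K).
    apply/idP/idP => Kz; first by rewrite -(mulfK y0 z) KD.
    by rewrite -[y]invrK KD // KV.
  pose D := K :\ 0; pose P := \prod_(z in D) z.
  have P0 : P != 0 by apply/prodf_neq0 => z; rewrite !inE => /andP[].
  have yD : P = P * y ^+ #|D|.
    rewrite -prodr_const -big_split /= [LHS](reindex_inj (mulIf y0)) /=.
    by apply: eq_bigl => z; rewrite !inE KM mulf_eq0 (negPf y0) orbF.
  have : y ^+ #|D| = 1 by apply: (mulfI P0); rewrite -yD mulr1.
  by rewrite -cardK (cardsD1 0 K) K0 add1n exprS => ->; rewrite mulr1.
have q_gt1 : (1 < q)%N.
  rewrite -cardK (cardsD1 0 K) K0 (cardsD1 1) !inE K1 oner_eq0.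
  by rewrite addnA ltn_addr.
apply: (iffP idP) => [/Kfix //|xq]; apply: contraT => Kx.
have szP : size ('X^q - 'X : {poly L}) = q.+1.
  by rewrite size_polyDl ?size_polyXn // size_polyN size_polyX.
have P0 : 'X^q - 'X != 0 :> {poly L} by rewrite -size_poly_eq0 szP.
have rootP y : y ^+ q = y -> root ('X^q - 'X) y.
  by move=> yq; rewrite /root !hornerE hornerXn yq subrr.
have rs : all (root ('X^q - 'X)) (x :: enum K).
  rewrite /= rootP //; apply/allP => y; rewrite mem_enum => /Kfix.
  exact: rootP.
have := max_poly_roots P0 rs; rewrite /= mem_enum Kx enum_uniq szP -cardE cardK.
by rewrite ltnn => /(_ isT).
Qed.

Section Trace.

Variables (p n m : nat) (L : finFieldType) (K : {set L}).
Hypotheses (hp : prime p) (hn : (0 < n)%N) (hm : (0 < m)%N).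
Hypotheses (hL : #|L| = (p ^ (m * n))%N) (hK : is_subfield (p ^ m) K).

Local Notation Tr := (trace p m (m * n)).

Let pL : p \in [pchar L].
Proof. exact: card_finPcharP hL hp. Qed.

Lemma traceE (x : L) : Tr x = \sum_(j < n) x ^+ ((p ^ m) ^ j).
Proof.
by rewrite /trace mulKn //; apply: eq_bigr => j _; rewrite mulnC expnM.
Qed.

Lemma traceD (x y : L) : Tr (x + y) = Tr x + Tr y.
Proof.
rewrite !traceE -big_split; apply: eq_bigr => j _ /=.
have := @expr_sum_pchar L p (m * j) _ [:: x; y] xpredT id pL.
by rewrite !big_cons !big_nil /= !addr0 expnM.
Qed.

Lemma trace0 : Tr (0 : L) = 0.
Proof. by apply: (addrI (Tr 0)); rewrite -traceD !addr0. Qed.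

Lemma trace_sum (I : Type) (r : seq I) (F : I -> L) :
  Tr (\sum_(i <- r) F i) = \sum_(i <- r) Tr (F i).
Proof. exact: (big_morph _ traceD trace0). Qed.

Lemma traceZ (a x : L) : a \in K -> Tr (a * x) = a * Tr x.
Proof.
move=> /(subfield_fixP _ hK) aq; rewrite !traceE mulr_sumr.
by apply: eq_bigr => j _; rewrite exprMn (expr_iter_fix _ aq).
Qed.

Lemma trace_subfield (a : L) : a \in K -> Tr a = a *+ n.
Proof.
move=> /(subfield_fixP _ hK) aq; rewrite traceE.
under eq_bigr do rewrite (expr_iter_fix _ aq).
by rewrite sumr_const card_ord.
Qed.

Lemma trace_in (x : L) : Tr x \in K.
Proof.
apply/(subfield_fixP _ hK); rewrite traceE (expr_sum_pchar _ _ _ _ pL).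
under eq_bigr do rewrite -exprM -expnSr.
(* The [p ^ m]-th power shifts the summands cyclically: the last one becomes [x ^+ #|L| = x], the
   first summand of the original sum. *)
case: n hn hL => // n' _ cardL; rewrite big_ord_recr big_ord_recl /= addrC.
by rewrite -expnM -cardL expf_card expr1.
Qed.

(** The trace is given by a polynomial of degree [(p ^ m) ^ (n - 1)], less than [#|L|], so it cannot
    vanish on all of [L]. *)
Lemma trace_neq0 : exists x : L, Tr x != 0.
Proof.
apply/existsP; apply: contraT; rewrite negb_exists => /forallP Tr0.
have q_gt1 : (1 < p ^ m)%N by rewrite -(exp1n m) ltn_exp2r // prime_gt1.
case: n hn hL Tr0 traceE => // n' _ cardL Tr0 TrE.
pose T : {poly L} := \sum_(j < n'.+1) 'X^((p ^ m) ^ j).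
have szT : size T = ((p ^ m) ^ n').+1.
  rewrite /T big_ord_recr /= addrC size_polyDl ?size_polyXn // ltnS.
  apply: (leq_trans (size_sum _ _ _)); apply/bigmax_leqP => j _.
  by rewrite size_polyXn ltn_exp2l.
have T0 : T != 0 by rewrite -size_poly_eq0 szT.
have rs : all (root T) (enum L).
  apply/allP => x _; rewrite /root horner_sum.
  under eq_bigr do rewrite hornerXn.
  by rewrite -TrE -[_ == 0]negbK Tr0.
have := max_poly_roots T0 rs (enum_uniq _).
by rewrite szT -cardE cardL expnM ltnS leq_exp2l // ltnn.
Qed.

(** By linearity over [K], one nonzero value can be rescaled to any element of [K]. *)
Lemma trace_surj (a : L) : a \in K -> exists x, Tr x = a.
Proof.
move=> Ka; have [c c0] := trace_neq0; exists (a / Tr c * c).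
have [[_ _ KD] _] := hK.
by rewrite traceZ ?KD ?trace_in // mulfVK.
Qed.

Lemma trace_h_map (d k : nat) (delta : L) (b : 'I_k -> L) (s : 'I_k -> nat)
    (y : L) :
  (d %| p ^ m - 1)%N -> (p %| n)%N -> Tr delta = 0 ->
  (forall i, b i \in K) -> y \in K -> Tr (h_map p d n m delta b s y) = 0.
Proof.
move=> hdm hpn hdelta hb Ky; rewrite /h_map trace_sum big1 // => i _.
rewrite traceZ //; set u := y + delta.
have Tru : Tr u = 0.
  rewrite traceD hdelta addr0 trace_subfield // -mulr_natr.
  by case/dvdnP: hpn => c ->; rewrite natrM (pcharf0 pL) !mulr0.
rewrite add1n exprS.
(* The root of unity argument needs [u] invertible; at [u = 0] the split-off factor [u] kills the
   term. *)
have [->|u0] := eqVneq u 0; first by rewrite mul0r trace0 mulr0.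
set e := (_ %/ d)%N; suff Kw : u ^+ e \in K.
  by rewrite [u * _]mulrC traceZ // Tru !mulr0.
have q_gt0 : (0 < p ^ m)%N by rewrite expn_gt0 prime_gt0.
have u1 : u ^+ (p ^ (n * m) - 1) = 1.
  apply: (mulfI u0); rewrite -exprS mulr1 subn1 prednK ?expn_gt0 ?prime_gt0 //.
  by rewrite mulnC -hL expf_card.
(* The division by [d] in [e] is exact, since [d] divides [p ^ m - 1], which divides
   [p ^ (n * m) - 1]. *)
have wd : (u ^+ e) ^+ d = 1.
  rewrite -exprM divnK; first by rewrite mulnC exprM u1 expr1n.
  apply/dvdn_mull/(dvdn_trans hdm).
  by rewrite mulnC expnM !subn1; apply: dvdn_pred_predX.
apply/(subfield_fixP _ hK); rewrite -[X in _ ^+ X](subnK q_gt0).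
by case/dvdnP: hdm => c ->; rewrite addn1 exprS mulnC exprM wd expr1n mulr1.
Qed.

End Trace.

Theorem theorem2 (p d n m : nat) (hp : prime p)
    (hd : (0 < d)%N) (hn : (0 < n)%N) (hm : (0 < m)%N)
    (hdm : (d %| p ^ m - 1)%N) (hpn : (p %| n)%N)
    (L : finFieldType) (hL : #|L| = (p ^ (m * n))%N)
    (K : {set L}) (hK : is_subfield (p ^ m) K)
    (delta : L) (hdelta : trace p m (m * n) delta = 0)
    (f1 varphi : {poly L}) (hvarphi : varphi \is a polyOver K)
    (h_trace : forall x : L,
       trace p m (m * n) f1.[x] = varphi.[trace p m (m * n) x])
    (h_inj : forall a : L, a \in K ->
       {in [set x : L | trace p m (m * n) x == a] &,
          injective (fun x => f1.[x])})
    (k : nat) (hk : (0 < k)%N)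
    (b : 'I_k -> L) (hb : forall i, b i \in K)
    (s : 'I_k -> nat) (hs : forall i, (0 < s i)%N) :
  (permutes [set: L] (f_map p d n m delta b s f1) <->
     permutes K (fun x => varphi.[x])) /\
  (permutes [set: L] (f_map p d n m delta b s f1) ->
   forall phi phibar : {poly L},
   permutes [set: L] (Psi_map p n m f1 phi phibar) ->
   forall varphi_inv Psi_inv : L -> L,
   comp_inverse K (fun x => varphi.[x]) varphi_inv ->
   comp_inverse [set: L] (Psi_map p n m f1 phi phibar) Psi_inv ->
   comp_inverse [set: L] (f_map p d n m delta b s f1)
     (fun x : L =>
        let y := varphi_inv (trace p m (m * n) x) in
        Psi_inv (phi.[x - h_map p d n m delta b s y] + phibar.[y]))).
Proof.
have tr_h y : y \in K -> trace p m (m * n) (h_map p d n m delta b s y) = 0.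
  exact: (@trace_h_map p n m L K).
have trK x : trace p m (m * n) x \in K by apply: (@trace_in p n m L K).
have trD := @traceD p n m L hp hm hL.
have tr_onto a : a \in K -> exists x, trace p m (m * n) x = a.
  exact: (@trace_surj p n m L K).
have fE x : f_map p d n m delta b s f1 x =
    h_map p d n m delta b s (trace p m (m * n) x) + f1.[x] by [].
have tr_f x : trace p m (m * n) (f_map p d n m delta b s f1 x) =
    varphi.[trace p m (m * n) x].
  by rewrite fE trD tr_h // add0r h_trace.
(* Each [a] in [K] is a trace, so [varphi.[a]] is the trace of a value of [f1]. *)
have varphiK a : a \in K -> varphi.[a] \in K.
  by case/tr_onto => x <-; rewrite -h_trace.
split; first split.
- case=> _ _ f_onto.
  have onto : {in K, forall y, exists2 x, x \in K & varphi.[x] = y}.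
    move=> y /tr_onto[z <-]; have [x _ <-] := f_onto z (in_setT z).
    by exists (trace p m (m * n) x); rewrite ?tr_f.
  (* A surjective self-map of the finite set [K] is injective, by counting its image. *)
  split=> //; apply/imset_injP; rewrite eqn_leq leq_imset_card /=.
  apply/subset_leq_card/subsetP => y /onto[x Kx <-].
  exact: (imset_f (fun x => varphi.[x])).
- case=> _ varphi_inj _.
  have f_inj : injective (f_map p d n m delta b s f1).
    move=> x x' eq_f; have eq_tr : trace p m (m * n) x = trace p m (m * n) x'.
      by apply: varphi_inj => //; rewrite -!tr_f eq_f.
    (* Both points lie in one fibre of the trace, where the [h_map] summands agree and cancel. *)
    apply: (h_inj _ (trK x')); rewrite ?inE ?eq_tr //.
    by apply: (addrI (h_map p d n m delta b s (trace p m (m * n) x')));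
      rewrite -{1}eq_tr -!fE.
  split=> [x _|x y _ _|y _]; rewrite ?inE //; first exact: f_inj.
  have [g _ gK] := injF_bij f_inj.
  by exists (g y).
move=> [_ _ f_onto] phi phibar _ vi Pi [_ _ vK _] [_ _ PK _].
set g := (fun x : L => _).
(* At [f x], [vi] recovers [Tr x]; subtracting [h (Tr x)] then leaves [f1.[x]], so [Pi] is applied
   to the value of [Psi_map] at [x]. *)
have fK x : g (f_map p d n m delta b s f1 x) = x.
  by rewrite /g /= tr_f vK // fE addrAC subrr add0r -[RHS]PK.
split=> [x _|x _|x _|y _]; rewrite ?inE ?fK //.
(* As [f] is onto, its left inverse is also a right inverse. *)
by have [x _ <-] := f_onto y (in_setT y); rewrite fK.
Qed.
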